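(* Let $T=\sum_{j=1}^kQ_jD^j$ be a degenerate exactly-solvable operator of order $k$ such that $\deg Q_j=0$ for all $j>j_0$, where $j_0$ is the largest $j$ for which $\deg Q_j=j$. Then $\lim_{n\to\infty}\frac{r_n}{n^{\gamma}}=\infty$ for any real $\gamma<\frac{k-j_0}{k}$.
   Context: Here $D=d/dz$. A degenerate exactly-solvable operator of order $k$ is a linear differential operator $T=\sum_{j=1}^{k}Q_jD^j$ with polynomial coefficients $Q_j\in\mathbb{C}[z]$, $Q_k\not\equiv 0$, such that $\deg Q_j\leq j$ for all $j$, with equality for at least one $j$, and $\deg Q_k<k$. For all sufficiently large integers $n$ there exist a unique constant $\lambda_n$ and a unique monic polynomial $p_n$ of degree $n$ with $T(p_n)=\lambda_n p_n$. For such $n$, $r_n=\max\{|z|:p_n(z)=0\}$. Conditions on $\deg Q_j$ refer only to indices $j$ for which $Q_j$ is not identically zero. *)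

(* Defs.v *)
(* MathComp + MathComp-Analysis; the complex numbers are R[i] for a realType R. *)
From mathcomp Require Import all_boot all_order all_algebra.
From mathcomp Require Import complex.
From mathcomp Require Import all_classical all_reals all_analysis.

Set Implicit Arguments.
Unset Strict Implicit.
Unset Printing Implicit Defensive.

Import Order.TTheory GRing.Theory Num.Theory.
Import numFieldNormedType.Exports.

Local Open Scope classical_set_scope.
Local Open Scope ring_scope.
Local Open Scope complex_scope.

(* Only the coefficients Q 1, ..., Q k of a family Q are relevant. *)
Definition diffop (R : realType) (k : nat) (Q : nat -> {poly R[i]})
    (p : {poly R[i]}) : {poly R[i]} :=
  \sum_(1 <= j < k.+1) Q j * p^`(j).

(* size q = (deg q).+1 for q != 0 and size 0 = 0; in particular, the bound
   size (Q j) <= j.+1 holds for Q j = 0. *)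
Definition degenerate_exactly_solvable (R : realType) (k : nat)
    (Q : nat -> {poly R[i]}) : Prop :=
  [/\ Q k != 0,
      forall j : nat, (1 <= j <= k)%N -> (size (Q j) <= j.+1)%N,
      exists j : nat, (1 <= j <= k)%N /\ size (Q j) = j.+1
    & (size (Q k) <= k)%N].

Definition top_index (R : realType) (k : nat) (Q : nat -> {poly R[i]}) : nat :=
  (\max_(1 <= j < k.+1 | size (Q j) == j.+1) j)%N.

Definition is_monic_eigenpoly (R : realType) (k : nat) (Q : nat -> {poly R[i]})
    (n : nat) (p : {poly R[i]}) : Prop :=
  [/\ p \is monic, size p = n.+1
    & exists lambda : R[i], diffop k Q p = lambda *: p].

(* For a degenerate exactly-solvable operator and n large enough, the set below
   is a singleton; the value 0 is only used when it is empty. *)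
Definition monic_eigenpoly (R : realType) (k : nat) (Q : nat -> {poly R[i]})
    (n : nat) : {poly R[i]} :=
  xget 0 [set p | is_monic_eigenpoly k Q n p].

(* The norm on R[i] takes its values in R[i], hence the real part. For a
   nonconstant p the set is finite and nonempty, so sup is its maximum. *)
Definition max_root_modulus (R : realType) (p : {poly R[i]}) : R :=
  sup [set complex.Re `|z| | z in [set z | root p z]].

(* Main.v *)
Require Import Defs.
From mathcomp Require Import all_boot all_order all_algebra.
From mathcomp Require Import complex.
From mathcomp Require Import all_classical all_reals all_analysis.
From mathcomp Require Import ring lra zify.

(* If all zeros of a polynomial p of degree n lie in |a| <= r and |z| >= 3^j r,
   then |z^j p^(j)(z) / p(z)| lies between 2^-j and 2^j times the falling
   factorial n(n-1)...(n-j+1). Suppose the zeros of the eigenpolynomial p_n lie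
   in |a| <= rho / 3^k with 1 <= rho <= n, divide T(p_n) = lambda_n p_n by p_n
   and evaluate at |z| = rho. As Q_k is a nonzero constant, the term j = k has
   order (n / rho)^k. Here lambda_n and the terms j <= j_0 are O(n^j_0), and for
   j_0 < j < k the constant Q_j gives a term O((n / rho)^(k-1)), so
     c (n / rho)^k <= A (n^j_0 + (n / rho)^(k-1)).
   This is absurd for rho = n^g with 0 < g < (k - j_0) / k and n large. *)

Import Order.TTheory GRing.Theory Num.Theory.
Import numFieldNormedType.Exports.

Local Open Scope classical_set_scope.
Local Open Scope ring_scope.
Local Open Scope complex_scope.

(** * Derivatives of a polynomial at points far from its zeros *)

Lemma deriv_prod_XsubC (F : fieldType) (s : seq F) (z : F) :
  all (fun a => z != a) s ->
  (\prod_(a <- s) ('X - a%:P))^`().[z] =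
  (\prod_(a <- s) ('X - a%:P)).[z] * \sum_(a <- s) (z - a)^-1.
Proof.
elim: s => [_|a s IHs /= /andP[za zs]].
  by rewrite !big_nil mulr0 -[1]/(1%:P) derivC horner0.
rewrite !big_cons derivM hornerD !hornerM (IHs zs) derivXsubC hornerXsubC hornerC.
have za0 : z - a != 0 by rewrite subr_eq0.
by field.
Qed.

(** With n the degree, z p'(z) / p(z) - n is the sum of a / (z - a) over the zeros a. Since |a| <=
    |z| / 3, each |z - a| is at least 2|z| / 3, so each summand is at most 1/2. *)
Lemma deriv_horner_approx (C : numClosedFieldType) (p : {poly C}) (r z : C) :
  (forall a, root p a -> `|a| <= r) -> 0 < `|z| -> 3%:R * r <= `|z| ->
  `|z * p^`().[z] - (size p).-1%:R * p.[z]| <= (size p).-1%:R / 2%:R * `|p.[z]|.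
Proof.
move=> pr z0 rz.
have [->|p0] := eqVneq p 0; first
  by rewrite deriv0 !horner0 !mulr0 subrr normr0 mulr0.
have [s ps] := closed_field_poly_normal p.
have c0 : lead_coef p != 0 by rewrite lead_coef_eq0.
have szs : (size p).-1 = size s by rewrite ps size_scale // size_prod_XsubC.
have sr a : a \in s -> `|a| <= r.
  by move=> sa; apply: pr; rewrite ps rootZ // root_prod_XsubC.
have sz a : a \in s -> 3%:R * `|a| <= `|z|.
  by move=> sa; rewrite (le_trans _ rz)// ler_pM2l ?sr.
have nz a : a \in s -> 2%:R / 3%:R * `|z| <= `|z - a|.
  move=> sa; apply: le_trans (lerB_dist _ _).
  rewrite lerBrDl -lerBrDr.
  have -> : `|z| - 2%:R / 3%:R * `|z| = `|z| / 3%:R by field.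
  by rewrite ler_pdivlMr // mulrC sz.
have za a : a \in s -> z != a.
  move=> sa; rewrite -subr_eq0 -normr_gt0; apply: lt_le_trans (nz _ sa).
  by rewrite mulr_gt0 // divr_gt0.
rewrite szs ps derivZ !hornerZ deriv_prod_XsubC; last by apply/allP => a /za.
set P := (\prod_(a <- s) _).[z].
have -> : z * (lead_coef p * (P * \sum_(a <- s) (z - a)^-1)) -
    (size s)%:R * (lead_coef p * P) =
    (\sum_(a <- s) a / (z - a)) * (lead_coef p * P).
  have -> : \sum_(a <- s) a / (z - a) = z * \sum_(a <- s) (z - a)^-1 - (size s)%:R.
    have -> : (size s)%:R = \sum_(a <- s) 1 :> C.
      by rewrite big_const_seq count_predT iter_addr_0.
    rewrite mulr_sumr -sumrB big_seq [RHS]big_seq; apply: eq_bigr => a sa.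
    have za0 : z - a != 0 by rewrite subr_eq0 za.
    by field.
  by ring.
rewrite normrM ler_wpM2r //.
apply: le_trans (ler_norm_sum _ _ _) _.
have -> : (size s)%:R / 2%:R = \sum_(a <- s) 2%:R^-1 :> C.
  by rewrite big_const_seq count_predT iter_addr_0 mulr_natl.
rewrite big_seq [leRHS]big_seq ler_sum // => a sa.
rewrite normf_div ler_pdivrMr; last by rewrite normr_gt0 subr_eq0 za.
rewrite -(ler_pM2l (x := 2%:R)) // mulrA mulfV // mul1r.
apply: le_trans (nz _ sa).
rewrite -(ler_pM2l (x := 3%:R)) //.
have -> : 3%:R * (2%:R / 3%:R * `|z|) = 2%:R * `|z| by field.
by rewrite mulrCA ler_pM2l // sz.
Qed.

(** The triangle inequality gives the factors 1/2 and 3/2; the latter is relaxed to 2, so that j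
    iterations give 2^-j and 2^j. *)
Lemma deriv_horner_bounds (C : numClosedFieldType) (p : {poly C}) (r z : C) :
  (forall a, root p a -> `|a| <= r) -> 0 < `|z| -> 3%:R * r <= `|z| ->
  (size p).-1%:R / 2%:R * `|p.[z]| <= `|z| * `|p^`().[z]|
    <= 2%:R * (size p).-1%:R * `|p.[z]|.
Proof.
move=> pr z0 rz; have := deriv_horner_approx _ _ _ _ pr z0 rz.
set n := (size p).-1%:R; set d := p^`().[z]; move=> H.
have n0 : 0 <= n by rewrite ler0n.
have nn : `|n * p.[z]| = n * `|p.[z]| by rewrite normrM ger0_norm.
rewrite -normrM; apply/andP; split.
  have : n * `|p.[z]| - n / 2%:R * `|p.[z]| <= `|z * d|.
    rewrite lerBlDr -nn -(subrK (z * d) (n * p.[z])) addrC.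
    by apply: le_trans (ler_normD _ _) _; rewrite lerD2l distrC.
  by congr (_ <= _); field.
rewrite -(subrK (n * p.[z]) (z * d)).
apply: le_trans (ler_normD _ _) _; rewrite nn.
apply: (@le_trans _ _ (n / 2%:R * `|p.[z]| + n * `|p.[z]|)); first
  by rewrite lerD2r.
rewrite -mulrDl ler_wpM2r // mulr_natl [leRHS]mulr2n lerD2r.
by rewrite ler_pdivrMr // ler_peMr // ler1n.
Qed.

(* The Gauss-Lucas theorem has r in place of 3 r; this weak form is enough. *)
Lemma root_deriv_disk (C : numClosedFieldType) (p : {poly C}) (r : C) :
  (1 < size p)%N -> (forall a, root p a -> `|a| <= r) ->
  forall a, root p^`() a -> `|a| <= 3%:R * r.
Proof.
move=> p1 pr a ra.
have rr : r \is Num.real.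
  have /closed_rootP[b /pr rb] : size p != 1 by rewrite neq_ltn p1 orbT.
  by apply: ger0_real; apply: le_trans rb.
have r0 : 0 <= r.
  have /closed_rootP[b /pr rb] : size p != 1 by rewrite neq_ltn p1 orbT.
  by apply: le_trans rb.
case: (real_leP (normr_real a) (_ : 3%:R * r \is Num.real)) => [|//|lt_ra].
  by rewrite realM.
have a0 : 0 < `|a| by apply: le_lt_trans lt_ra; rewrite mulr_ge0.
(* At a zero of p' with |a| > 3 r the lower bound forces p(a) = 0, hence |a| <= r, which is
   absurd. *)
have /andP[+ _] := deriv_horner_bounds _ _ _ _ pr a0 (ltW lt_ra).
rewrite (rootP ra) normr0 mulr0 pmulr_rle0; last first.
  by rewrite divr_gt0 // ltr0n -subn1 subn_gt0.
rewrite normr_le0 => /eqP pa0.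
have /pr ar : root p a by apply/rootP.
have := lt_le_trans lt_ra ar; rewrite -subr_lt0.
have -> : 3%:R * r - r = 2%:R * r by ring.
by rewrite pmulr_rlt0 // (le_gtF r0).
Qed.

Lemma size_deriv_num (C : numFieldType) (p : {poly C}) :
  size p^`() = (size p).-1.
Proof.
have [p1|p1] := leqP (size p) 1.
  by rewrite (size1_polyC p1) derivC size_poly0 size_polyC; case: eqP.
rewrite /deriv size_poly_eq //.
rewrite -mulr_natr mulf_neq0 ?pnatr_eq0 //.
rewrite (_ : (size p).-2.+1 = (size p).-1); last by lia.
by rewrite lead_coef_eq0 -size_poly_gt0 ltnW.
Qed.

(** Induction on j, applied to p' with radius 3 r; each derivative triples the radius, whence 3^j.
    The degrees n, n - 1, ... multiply to the falling factorial. *)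
Lemma derivn_horner_bounds (C : numClosedFieldType) (p : {poly C}) (r z : C) j :
  (j < size p)%N ->
  (forall a, root p a -> `|a| <= r) -> 0 < `|z| -> 3%:R ^+ j * r <= `|z| ->
  ((size p).-1 ^_ j)%:R / 2%:R ^+ j * `|p.[z]| <= `|z| ^+ j * `|p^`(j).[z]|
    <= 2%:R ^+ j * ((size p).-1 ^_ j)%:R * `|p.[z]|.
Proof.
elim: j p r => [|j IHj] p r jp pr z0 rz.
  by rewrite ffactn0 !expr0 divr1 !mul1r lexx.
have p1 : (1 < size p)%N by lia.
have r0 : 0 <= r.
  have /closed_rootP[b /pr rb] : size p != 1 by rewrite neq_ltn p1 orbT.
  by apply: le_trans rb.
have p'r := root_deriv_disk _ _ _ p1 pr.
have /IHj -/(_ _ p'r z0) : (j < size p^`())%N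
  by rewrite size_deriv_num -ltnS prednK // ltnW.
rewrite mulrA -exprSr => /(_ rz); rewrite size_deriv_num -derivSn => /andP[L U].
have /andP[L1 U1] : (size p).-1%:R / 2%:R * `|p.[z]| <= `|z| * `|p^`().[z]|
    <= 2%:R * (size p).-1%:R * `|p.[z]|.
  apply: deriv_horner_bounds pr z0 (le_trans _ rz).
  by rewrite ler_wpM2r // exprS ler_peMr // exprn_ege1 // ler1n.
have -> : ((size p).-1 ^_ j.+1)%:R = (size p).-1%:R * ((size p).-1.-1 ^_ j)%:R :> C.
  by rewrite ffactnS natrM.
set a := ((size p).-1.-1 ^_ j)%:R; set n := (size p).-1%:R.
have a0 : 0 <= a :> C by rewrite ler0n.
have two : 0 < 2%:R ^+ j :> C by rewrite exprn_gt0.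
rewrite (exprS `|z|) -(mulrA `|z|); apply/andP; split.
  apply: (@le_trans _ _ (`|z| * (a / 2%:R ^+ j * `|p^`().[z]|))); last first.
    by rewrite ler_wpM2l.
  rewrite mulrCA.
  have -> : n * a / 2%:R ^+ j.+1 * `|p.[z]| = a / 2%:R ^+ j * (n / 2%:R * `|p.[z]|).
    by rewrite exprS invfM; ring.
  by rewrite ler_wpM2l // divr_ge0 // ltW.
apply: (@le_trans _ _ (`|z| * (2%:R ^+ j * a * `|p^`().[z]|))).
  by rewrite ler_wpM2l.
rewrite mulrCA.
have -> : 2%:R ^+ j.+1 * (n * a) * `|p.[z]| = 2%:R ^+ j * a * (2%:R * n * `|p.[z]|).
  by rewrite exprS; ring.
by rewrite ler_wpM2l // mulr_ge0 // ltW.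
Qed.

(** * Falling factorials and the separation of eigenvalues *)

Lemma leq_ffact (m n j : nat) : (m <= n)%N -> (m ^_ j <= n ^_ j)%N.
Proof.
move=> mn; elim: j => // j IHj.
by rewrite !ffactnSr leq_mul // leq_sub2r.
Qed.

Lemma ffact_leq_expn (n j : nat) : (n ^_ j <= n ^ j)%N.
Proof.
elim: j => // j IHj.
by rewrite ffactnSr expnSr leq_mul // leq_subr.
Qed.

(** Each factor n - i with i < k is at least n / 2. *)
Lemma expn_leq_ffact (n k : nat) :
  (2 * k <= n)%N -> (n ^ k <= 2 ^ k * n ^_ k)%N.
Proof.
elim: k => // k IHk kn.
rewrite ffactnSr !expnSr mulnACA leq_mul //; last by lia.
by apply: IHk; lia.
Qed.

(** Together with [ffact_sub_leq], a discrete mean value estimate for falling factorials. Here it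
    follows from splitting off the first factor and bounding the rest by [n ^_ j]. *)
Lemma ffact_sub_geq (m n j : nat) : (m <= n.+1)%N ->
  (m ^_ j.+1 + (n.+1 - m) * n ^_ j <= n.+1 ^_ j.+1)%N.
Proof.
case: m => [_|m mn]; first by rewrite ffact0n subn0 ffactSS.
rewrite !ffactSS subSS.
apply: (@leq_trans (m.+1 * n ^_ j + (n - m) * n ^_ j)).
  by rewrite leq_add2r leq_mul // leq_ffact.
by rewrite -mulnDl addSn subnKC.
Qed.

(** Telescoping: consecutive values at i and i + 1 differ by [j.+1 * i ^_ j], and i <= n - 1. *)
Lemma ffact_sub_leq (m n j : nat) : (m <= n)%N ->
  (n ^_ j.+1 <= m ^_ j.+1 + (n - m) * (j.+1 * n.-1 ^_ j))%N.
Proof.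
elim: n => [|n IHn]; first by rewrite leqn0 => /eqP ->.
rewrite leq_eqVlt => /predU1P[->|]; first by rewrite leq_addr.
rewrite ltnS => mn.
have -> : (n.+1 ^_ j.+1 = n ^_ j.+1 + j.+1 * n ^_ j)%N.
  rewrite ffactSS ffactnSr [(n ^_ j * _)%N]mulnC -mulnDl.
  have [jn|nj] := leqP j n; first by congr (_ * _)%N; lia.
  by rewrite ffact_small // !muln0.
rewrite subSn // [((n - m).+1 * _)%N]mulSn [(_ + (n - m) * _)%N]addnC addnA leq_add2r.
apply: leq_trans (IHn mn) _.
by rewrite leq_add2l !leq_mul // leq_ffact // leq_pred.
Qed.

Lemma ffact_lt_mul (n i d : nat) : (i < d)%N ->
  (n ^_ i * (n - d) <= n ^_ d)%N.
Proof.
elim: d => // d IHd; rewrite ltnS leq_eqVlt => /predU1P[->|i_d].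
  by rewrite ffactnSr leq_mul // leq_sub2l.
rewrite ffactnSr; have [nd|dn] := leqP n d.
  by rewrite (_ : n - d.+1 = 0)%N ?muln0 //; lia.
apply: (@leq_trans (n ^_ i * (n - d) * (n - d))); last by rewrite leq_mul // IHd.
rewrite -mulnA leq_mul2l; apply/orP; right.
by apply: leq_trans (leq_pmulr _ _); lia.
Qed.

Lemma complex_archi (R : realType) (x : R[i]) : exists N : nat, `|x| < N%:R.
Proof.
have xE : `|x| = (complex.Re `|x|)%:C by rewrite RRe_real ?normr_real.
have x0 : 0 <= complex.Re `|x| by rewrite -lecR -xE; exact: normr_ge0.
exists (Num.bound (complex.Re `|x|)).
by rewrite xE -(rmorph_nat (real_complex R)) ltcR archi_boundP.
Qed.

(** If the two sums agreed, the difference of the top terms would be balanced by the lower ones.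
    Both sides carry the factor n - m, but the lower terms are smaller by a factor of order n; hence
    the threshold is uniform in m. Applied to the eigenvalues, this makes the n-th one differ from
    all earlier ones. *)
Lemma ffact_sum_neq (R : realType) (d : nat) (q : nat -> R[i]) :
  (0 < d)%N -> q d != 0 ->
  exists N : nat, forall n m : nat, (N <= n)%N -> (m < n)%N ->
    \sum_(1 <= j < d.+1) q j * (n ^_ j)%:R !=
    \sum_(1 <= j < d.+1) q j * (m ^_ j)%:R.
Proof.
case: d => // d _ qd.
set S := \sum_(1 <= j < d.+1) `|q j| * j%:R.
have S0 : 0 <= S by apply: sumr_ge0 => j _; rewrite mulr_ge0.
have [N0 HN] := complex_archi _ (S / q d.+1).
(* After the shift of n by one, this gives n - d >= N0 > S / |q_(d+1)|. *)
exists (N0 + d).+1 => -[//|n] m Nn mn; apply/eqP => /eqP.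
rewrite !(big_nat_recr d.+1) //= -subr_eq0 opprD addrACA -sumrB -mulrBr.
rewrite addrC addr_eq0 => /eqP E.
have mn' : (m <= n.+1)%N by lia.
set x : R[i] := (n.+1 - m)%:R.
have x0 : 0 < x by rewrite ltr0n subn_gt0.
have U j : `|(n.+1 ^_ j.+1)%:R - (m ^_ j.+1)%:R| <= x * (j.+1%:R * (n ^_ j)%:R) :> R[i].
  rewrite -natrB ?leq_ffact // normr_nat -!natrM ler_nat leq_subLR.
  exact: ffact_sub_leq.
have L : x * (n ^_ d)%:R <= `|(n.+1 ^_ d.+1)%:R - (m ^_ d.+1)%:R| :> R[i].
  rewrite -natrB ?leq_ffact // normr_nat -!natrM ler_nat leq_subRL ?leq_ffact //.
  exact: ffact_sub_geq.
have nd0 : 0 < (n ^_ d)%:R :> R[i] by rewrite ltr0n ffact_gt0; lia.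
(* Multiplying by n - d raises every lower falling factorial to at most [n ^_ d]; the common factor
   [x * (n ^_ d)%:R] then cancels and leaves |q_(d+1)| (n - d) <= S. *)
have : `|q d.+1| * (x * (n ^_ d)%:R) * (n - d)%:R <= S * (x * (n ^_ d)%:R).
  apply: (@le_trans _ _
    (`|\sum_(1 <= j < d.+1) (q j * (n.+1 ^_ j)%:R -
      q j * (m ^_ j)%:R)| * (n - d)%:R)).
    by rewrite ler_wpM2r // -[leRHS]normrN -E normrM ler_wpM2l.
  rewrite mulr_suml; apply: le_trans (ler_wpM2r _ (ler_norm_sum _ _ _)) _ => //.
  rewrite mulr_suml !big_nat ler_sum // => -[//|j] /andP[_ jd].
  rewrite -mulrBr normrM -!mulrA ler_wpM2l //.
  apply: le_trans (ler_wpM2r _ (U j)) _ => //.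
  rewrite [leRHS]mulrCA -!mulrA ler_pM2l // ler_wpM2l // -natrM ler_nat.
  exact: ffact_lt_mul.
rewrite mulrAC ler_pM2r ?mulr_gt0 // => H.
have q0 : 0 < `|q d.+1| by rewrite normr_gt0.
move: HN; rewrite normf_div (ger0_norm S0) ltr_pdivrMr // => HN.
have := lt_le_trans (le_lt_trans H HN) (_ : _ <= `|q d.+1| * (n - d)%:R).
rewrite ltxx mulrC ler_wpM2l // ?ler_nat; first by move/(_ isT).
by lia.
Qed.

(** * Triangularity of the operator and existence of eigenpolynomials *)

(** When deg Q_j <= j for all j, this is the diagonal entry at z^m of the triangular matrix of T in
    the monomial basis. *)
Definition diffop_eigenvalue {R : realType} (k : nat) (Q : nat -> {poly R[i]})
    (m : nat) : R[i] :=
  \sum_(1 <= j < k.+1) (Q j)`_j * (m ^_ j)%:R.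

Lemma diffopB (R : realType) (k : nat) (Q : nat -> {poly R[i]})
    (p q : {poly R[i]}) :
  diffop k Q (p - q) = diffop k Q p - diffop k Q q.
Proof.
by rewrite /diffop -sumrB; apply: eq_bigr => j _; rewrite derivnB mulrBr.
Qed.

Lemma diffopZ (R : realType) (k : nat) (Q : nat -> {poly R[i]})
    (c : R[i]) (p : {poly R[i]}) :
  diffop k Q (c *: p) = c *: diffop k Q p.
Proof.
by rewrite /diffop scaler_sumr; apply: eq_bigr => j _; rewrite derivnZ scalerAr.
Qed.

(** In the coefficient of z^m in Q_j p^(j), the terms of Q_j of index below j meet coefficients of p
    beyond m, and those above j vanish by the degree bound; only index j survives. *)
Lemma coef_diffop (R : realType) (k : nat) (Q : nat -> {poly R[i]})
    (p : {poly R[i]}) (m : nat) :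
  (forall j, (1 <= j <= k)%N -> (size (Q j) <= j.+1)%N) ->
  (size p <= m.+1)%N -> (diffop k Q p)`_m = diffop_eigenvalue k Q m * p`_m.
Proof.
move=> sizeQ pm; rewrite /diffop coef_sum mulr_suml !big_nat.
apply: eq_bigr => j jk; have Qj := sizeQ j jk.
rewrite coefM; have [jm|mj] := leqP j m; last first.
  rewrite ffact_small // mulr0 mul0r big1 // => i _.
  rewrite coef_derivn (nth_default _ (_ : size p <= _)%N) ?mul0rn ?mulr0 //.
  by have := ltn_ord i; lia.
rewrite (bigD1 (inord j)) //= inordK // big1 => [|i ij].
  by rewrite addr0 coef_derivn subnKC // -mulrA mulr_natl.
have ijn : (i : nat) != j by apply: contra ij => /eqP <-; rewrite inord_val.
have [ilj|jli] := leqP i j; last by rewrite (nth_default _ (leq_trans Qj jli)) mul0r.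
rewrite coef_derivn (nth_default _ (_ : size p <= _)%N) ?mul0rn ?mulr0 //.
by have := ltn_ord i; lia.
Qed.

Lemma size_diffop (R : realType) (k : nat) (Q : nat -> {poly R[i]})
    (p : {poly R[i]}) (n : nat) :
  (forall j, (1 <= j <= k)%N -> (size (Q j) <= j.+1)%N) ->
  (size p <= n)%N -> (size (diffop k Q p) <= n)%N.
Proof.
move=> sizeQ pn; apply/leq_sizeP => m nm.
rewrite (coef_diffop _ _ _ _ _ sizeQ); last by apply: leq_trans pn _; lia.
by rewrite nth_default ?mulr0 // (leq_trans pn).
Qed.

(** T - mu is triangular on polynomials of degree below n, and its diagonal entries are nonzero. *)
Lemma diffop_sub_surj (R : realType) (k : nat) (Q : nat -> {poly R[i]})
    (mu : R[i]) (n : nat) :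
  (forall j, (1 <= j <= k)%N -> (size (Q j) <= j.+1)%N) ->
  (forall m, (m < n)%N -> diffop_eigenvalue k Q m != mu) ->
  forall f : {poly R[i]}, (size f <= n)%N ->
  exists2 g : {poly R[i]}, (size g <= n)%N & diffop k Q g - mu *: g = f.
Proof.
move=> sizeQ; elim: n => [|n IHn] lamn f szf.
  have -> : f = 0 by apply/eqP; rewrite -size_poly_leq0.
  exists 0; first by rewrite size_poly0.
  by have := diffopZ _ k Q 0 0; rewrite !scale0r => ->; rewrite scaler0 subr0.
have lam0 : diffop_eigenvalue k Q n - mu != 0 by rewrite subr_eq0 lamn.
(* The monomial h matches the top coefficient of f, so the remainder has lower degree. *)
set h : {poly R[i]} := (f`_n / (diffop_eigenvalue k Q n - mu)) *: 'X^n.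
have szh : (size h <= n.+1)%N.
  by apply: leq_trans (size_scale_leq _ _) _; rewrite size_polyXn.
have lamn' m : (m < n)%N -> diffop_eigenvalue k Q m != mu
  by move=> mn; apply: lamn; lia.
have [|g szg Tg] := IHn lamn' (f - (diffop k Q h - mu *: h)).
  apply/leq_sizeP => m; rewrite leq_eqVlt => /predU1P[<-|nm].
    rewrite !coefB coef_diffop // !coefZ coefXn eqxx mulr1 -mulrBl.
    by rewrite mulrCA mulfV // mulr1 subrr.
  apply: nth_default; apply: leq_trans nm.
  rewrite (leq_trans (size_polyD _ _)) // geq_max szf size_polyN.
  rewrite (leq_trans (size_polyD _ _)) // geq_max size_polyN size_diffop //.
  exact: leq_trans (size_scale_leq _ _) szh.
exists (g + h).
  by rewrite (leq_trans (size_polyD _ _)) // geq_max szh (leq_trans szg).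
have -> : g + h = g - (-1) *: h by rewrite scaleN1r opprK.
rewrite diffopB diffopZ scaleN1r opprK scalerBr scaleN1r scalerN opprK.
by rewrite opprD addrACA Tg subrK.
Qed.

(** The degree n coefficient of (T - lambda_n) z^n cancels, so this polynomial equals (T - lambda_n)
    g for some g of degree below n, and z^n - g is the eigenpolynomial. *)
Lemma exists_monic_eigenpoly (R : realType) (k : nat) (Q : nat -> {poly R[i]})
    (n : nat) :
  (forall j, (1 <= j <= k)%N -> (size (Q j) <= j.+1)%N) ->
  (forall m, (m < n)%N -> diffop_eigenvalue k Q m != diffop_eigenvalue k Q n) ->
  exists p, is_monic_eigenpoly k Q n p.
Proof.
move=> sizeQ lamn.
have szX : (size ('X^n : {poly R[i]}) <= n.+1)%N by rewrite size_polyXn.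
have [|g szg Tg] := diffop_sub_surj _ _ _ (diffop_eigenvalue k Q n) n sizeQ lamn
  (diffop k Q 'X^n - diffop_eigenvalue k Q n *: 'X^n).
  apply/leq_sizeP => m; rewrite leq_eqVlt => /predU1P[<-|nm].
    by rewrite coefB coef_diffop // coefZ subrr.
  apply: nth_default; apply: leq_trans nm.
  rewrite (leq_trans (size_polyD _ _)) // geq_max size_polyN size_diffop //.
  exact: leq_trans (size_scale_leq _ _) szX.
have szp : size ('X^n - g) = n.+1 by rewrite size_polyDl ?size_polyXn ?size_polyN.
exists ('X^n - g); split => //.
  rewrite monicE lead_coefDl ?lead_coefXn //.
  by rewrite size_polyN size_polyXn ltnS.
exists (diffop_eigenvalue k Q n); rewrite diffopB scalerBr.
by rewrite -[diffop k Q 'X^n](subrK (diffop_eigenvalue k Q n *: 'X^n)) -Tg; ring.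
Qed.

(** * The index j_0 and the growth inequality *)

Lemma top_indexP (R : realType) (k : nat) (Q : nat -> {poly R[i]}) :
  degenerate_exactly_solvable k Q ->
  [/\ (0 < top_index k Q < k)%N,
      size (Q (top_index k Q)) = (top_index k Q).+1
    & forall j, (1 <= j <= k)%N -> (top_index k Q < j)%N -> (size (Q j) <= j)%N].
Proof.
move=> [_ sizeQ [j1 [j1k sizej1]] sizeQk].
have le_top j : (1 <= j <= k)%N -> size (Q j) = j.+1 -> (j <= top_index k Q)%N.
  move=> jk szj; rewrite /top_index.
  apply: (@leq_bigmax_seq _ (index_iota 1 k.+1) _ (fun j => j)); rewrite ?szj //.
  by rewrite mem_index_iota ltnS.
have : exists2 j, (1 <= j <= k)%N & size (Q j) = j.+1 /\ top_index k Q = j.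
  (* The first alternative is the value 0 of an empty maximum; it is excluded below, since some Q_j
     has degree exactly j >= 1. *)
  pose K m := m = 0%N \/ exists2 j, (1 <= j <= k)%N & size (Q j) = j.+1 /\ m = j.
  have : K (top_index k Q).
    rewrite /top_index big_seq_cond; apply: (big_ind K) => [|x y Hx Hy|j].
    - by left.
    - by rewrite /maxn; case: ifP.
    - rewrite mem_index_iota ltnS => /andP[jk /eqP szj].
      by right; exists j.
  case=> // top0; have := le_top _ j1k sizej1.
  by rewrite top0; case/andP: j1k; case: (j1).
move=> [j jk [szj topj]]; split; rewrite ?topj //.
  case/andP: (jk) => -> jk'; rewrite ltn_neqAle jk' andbT.
  by apply: contraTneq sizeQk => <-; rewrite szj ltnn.
move=> i ik ji; have := sizeQ i ik; rewrite leq_eqVlt ltnS => /predU1P[szi|//].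
by have := le_top _ ik szi; rewrite topj leqNgt ji.
Qed.

Lemma horner_norm_le (C : numFieldType) (q : {poly C}) (z : C) (m : nat) :
  (size q <= m.+1)%N -> 1 <= `|z| ->
  `|q.[z]| <= (\sum_(i < size q) `|q`_i|) * `|z| ^+ m.
Proof.
move=> qm z1; rewrite horner_coef mulr_suml.
apply: le_trans (ler_norm_sum _ _ _) _; apply: ler_sum => i _.
rewrite normrM ler_wpM2l // normrX ler_weXn2l //.
by have := ltn_ord i; lia.
Qed.

(** The constants depend on Q alone; uniformity in n, z and p is what allows |z| to grow with n. *)
Lemma eigenpoly_growth_C (R : realType) (k : nat) (Q : nat -> {poly R[i]}) :
  degenerate_exactly_solvable k Q ->
  (forall j : nat, (top_index k Q < j <= k)%N -> Q j != 0 -> size (Q j) = 1%N) ->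
  exists c A : R[i], [/\ 0 < c, 0 <= A &
    forall (n : nat) (z : R[i]) (p : {poly R[i]}),
      (2 * k <= n)%N -> 1 <= `|z| -> `|z| <= n%:R ->
      is_monic_eigenpoly k Q n p ->
      (forall a, root p a -> `|a| <= `|z| / 3%:R ^+ k) ->
      c * (n%:R / `|z|) ^+ k <=
        A * (n%:R ^+ top_index k Q + (n%:R / `|z|) ^+ k.-1)].
Proof.
move=> hT hdeg; have [Qk0 sizeQ _ _] := hT.
have [/andP[t0 tk] szt topQ] := top_indexP _ _ _ hT.
set t := top_index k Q in hdeg t0 tk szt topQ *.
pose D j := \sum_(i < size (Q j)) `|(Q j)`_i|.
have D0 j : 0 <= D j by apply: sumr_ge0.
have sizeQ1 j : (t < j <= k)%N -> (size (Q j) <= 1)%N.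
  by move=> jk; have [->|/(hdeg _ jk) ->//] := eqVneq (Q j) 0; rewrite size_poly0.
have szQk : size (Q k) = 1%N by apply: hdeg => //; rewrite tk leqnn.
have Qkz z : (Q k).[z] = (Q k)`_0.
  by rewrite {1}[Q k]size1_polyC ?szQk // hornerC.
have q0 : 0 < `|(Q k)`_0|.
  by rewrite normr_gt0; move: Qk0; rewrite -lead_coef_eq0 lead_coefE szQk.
pose L := \sum_(1 <= j < k.+1) `|(Q j)`_j|.
have L0 : 0 <= L by apply: sumr_ge0.
pose M := \sum_(1 <= j < k) D j * 2%:R ^+ j.
have M0 : 0 <= M.
  by apply: sumr_ge0 => j _; rewrite mulr_ge0 // exprn_ge0.
(* One factor 2^-k comes from the derivative bound, another from comparing [n ^_ k] with n^k. L
   accounts for the eigenvalue, M for the terms 1 <= j < k. *)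
exists (`|(Q k)`_0| / 4%:R ^+ k), (L + M); split.
- by rewrite divr_gt0 // exprn_gt0.
- by rewrite addr_ge0.
move=> n z p kn z1 zn [pmon szp [mu eigp]] rootp.
have z0 : 0 < `|z| by apply: lt_le_trans z1.
have k_n : (k <= n)%N by apply: leq_trans kn; rewrite leq_pmull.
have n0 : (0 < n)%N by apply: leq_trans k_n; apply: leq_trans tk.
have n1 : 1 <= n%:R :> R[i] by rewrite ler1n.
have w1 : 1 <= n%:R / `|z| by rewrite ler_pdivlMr ?mul1r.
set w := n%:R / `|z| in w1 *.
have w0 : 0 <= w by apply: le_trans w1.
set G := n%:R ^+ t + w ^+ k.-1.
have nt_G : n%:R ^+ t <= G by rewrite lerDl exprn_ge0.
have w_G : w ^+ k.-1 <= G by rewrite lerDr exprn_ge0.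
have G0 : 0 <= G by apply: le_trans nt_G; rewrite exprn_ge0.
have three_k : 1 < 3%:R ^+ k :> R[i].
  by rewrite exprn_egt1 ?ltr1n // -lt0n (leq_trans _ tk).
(* A zero at z would satisfy |z| <= |z| / 3^k, while 3^k > 1. *)
have pz0 : 0 < `|p.[z]|.
  rewrite normr_gt0; apply/negP => /rootp.
  by rewrite ler_pdivlMr ?(lt_trans _ three_k) // ger_pMr // (lt_geF three_k).
have bounds j : (j <= k)%N ->
    (n ^_ j)%:R / 2%:R ^+ j * `|p.[z]| <= `|z| ^+ j * `|p^`(j).[z]|
      <= 2%:R ^+ j * (n ^_ j)%:R * `|p.[z]|.
  move=> jk; have -> : n = (size p).-1 by rewrite szp.
  apply: (derivn_horner_bounds _ _ (`|z| / 3%:R ^+ k) z j _ rootp z0).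
    by rewrite szp ltnS (leq_trans jk).
  rewrite mulrCA ger_pMr // ler_pdivrMr ?(lt_trans _ three_k) ?ltr01 // mul1r.
  by rewrite ler_weXn2l // ler1n.
(* Comparing coefficients of z^n identifies mu; the indices above j_0 contribute nothing to it,
   hence the order n^j_0. *)
have mu_le : `|mu| <= L * G.
  have -> : mu = diffop_eigenvalue k Q n.
    have pn : p`_n = 1 by move: pmon; rewrite monicE lead_coefE szp => /eqP.
    have := coef_diffop _ _ _ p n sizeQ; rewrite szp leqnn => /(_ isT).
    by rewrite eigp coefZ pn !mulr1.
  apply: le_trans (ler_norm_sum _ _ _) _.
  rewrite mulr_suml !big_nat ler_sum // => j jk.
  rewrite normrM normr_nat.
  have [jt|tj] := leqP j t; last first.
    by rewrite (nth_default _ (topQ _ jk tj)) normr0 !mul0r.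
  rewrite ler_wpM2l //; apply: le_trans nt_G.
  by rewrite -natrX ler_nat (leq_trans (ffact_leq_expn _ _)) // leq_pexp2l.
have term_le j : (1 <= j < k)%N ->
    `|(Q j).[z] * p^`(j).[z]| <= D j * 2%:R ^+ j * G * `|p.[z]|.
  move=> /andP[j1 jk].
  have jk' : (1 <= j <= k)%N by rewrite j1 ltnW.
  have zj0 : 0 < `|z| ^+ j by rewrite exprn_gt0.
  have : `|p^`(j).[z]| <= 2%:R ^+ j * (n%:R ^+ j / `|z| ^+ j) * `|p.[z]|.
    rewrite -(ler_pM2l zj0); have /andP[_ U] := bounds j (ltnW jk).
    apply: le_trans U _; rewrite [leRHS]mulrA ler_pM2r //.
    rewrite mulrCA [_ ^+ j * (_ / _)]mulrC divfK ?gt_eqF // ler_wpM2l ?exprn_ge0 //.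
    by rewrite -natrX ler_nat ffact_leq_expn.
  have D2 : 0 <= D j * 2%:R ^+ j by rewrite mulr_ge0 // exprn_ge0.
  (* For j <= j_0, the bound O(|z|^j) on Q_j(z) cancels the |z|^-j from the derivative. For j > j_0,
     Q_j is constant and w^j <= w^(k-1) because w >= 1. *)
  have [jt|tj] := leqP j t => pj.
    have Qz := horner_norm_le _ _ z _ (sizeQ j jk') z1.
    rewrite normrM; apply: le_trans (ler_pM _ _ Qz pj) _ => //.
    rewrite [leLHS]mulrA ler_pM2r //.
    have -> : D j * `|z| ^+ j * (2%:R ^+ j * (n%:R ^+ j / `|z| ^+ j)) =
        D j * 2%:R ^+ j * n%:R ^+ j by field; rewrite gt_eqF.
    rewrite ler_wpM2l //; apply: le_trans nt_G.
    by rewrite ler_weXn2l.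
  have szQj : (size (Q j) <= 1)%N by apply: sizeQ1; rewrite tj ltnW.
  have Qz := horner_norm_le _ _ z 0 szQj z1.
  rewrite normrM; apply: le_trans (ler_pM _ _ Qz pj) _ => //.
  rewrite expr0 mulr1 !mulrA ler_pM2r // -mulrA ler_wpM2l //.
  rewrite -expr_div_n; apply: le_trans w_G.
  by rewrite ler_weXn2l // -ltnS prednK // (leq_ltn_trans _ tk).
(* The eigenvalue equation at z is solved for its term of order k. *)
have main : `|(Q k)`_0| * `|p^`(k).[z]| <= (L + M) * G * `|p.[z]|.
  have k1 : (1 <= k)%N by apply: leq_ltn_trans tk.
  have E : (Q k)`_0 * p^`(k).[z] =
      mu * p.[z] - \sum_(1 <= j < k) (Q j).[z] * p^`(j).[z].
    have := congr1 (horner^~ z) eigp.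
    rewrite /diffop big_nat_recr //= hornerD hornerZ horner_sum hornerM Qkz => <-.
    by rewrite addrAC -sumrB big1 ?add0r // => j _; rewrite hornerM subrr.
  rewrite -normrM E; apply: le_trans (ler_normB _ _) _.
  rewrite !mulrDl lerD //; first by rewrite normrM ler_pM2r.
  apply: le_trans (ler_norm_sum _ _ _) _.
  by rewrite !mulr_suml !big_nat ler_sum.
rewrite -(ler_pM2r pz0); apply: le_trans main.
rewrite -!mulrA ler_pM2l //.
have /andP[low _] := bounds k (leqnn _).
have zk0 : 0 < `|z| ^+ k by rewrite exprn_gt0.
rewrite -(ler_pM2l zk0); apply: le_trans low.
rewrite [X in _ * X]mulrA [leLHS]mulrA ler_pM2r //.
rewrite /w expr_div_n mulrCA [_ ^+ k * (_ / _)]mulrC divfK ?gt_eqF //.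
rewrite mulrC ler_pdivrMr ?exprn_gt0 ?ltr0n //.
rewrite (_ : 4%:R = 2%:R * 2%:R); last by rewrite -natrM.
rewrite exprMn mulrA divfK ?expf_neq0 ?pnatr_eq0 //.
rewrite mulrC -!natrX -natrM ler_nat.
exact: expn_leq_ffact.
Qed.

(** The real form is obtained at the point z = rho; c and A are comparable with 0, hence real and
    equal to their real parts. *)
Lemma eigenpoly_growth (R : realType) (k : nat) (Q : nat -> {poly R[i]}) :
  degenerate_exactly_solvable k Q ->
  (forall j : nat, (top_index k Q < j <= k)%N -> Q j != 0 -> size (Q j) = 1%N) ->
  exists c A : R, [/\ 0 < c, 0 <= A &
    forall (n : nat) (rho : R) (p : {poly R[i]}),
      (2 * k <= n)%N -> 1 <= rho -> rho <= n%:R ->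
      is_monic_eigenpoly k Q n p ->
      (forall a, root p a -> complex.Re `|a| <= rho / 3%:R ^+ k) ->
      c * (n%:R / rho) ^+ k <=
        A * (n%:R ^+ top_index k Q + (n%:R / rho) ^+ k.-1)].
Proof.
move=> hT hdeg; have [c [A [c0 A0 H]]] := eigenpoly_growth_C _ _ _ hT hdeg.
have cE : (complex.Re c)%:C = c by rewrite RRe_real // gtr0_real.
have AE : (complex.Re A)%:C = A by rewrite RRe_real // ger0_real.
have nE m : m%:R = (m%:R : R)%:C by rewrite rmorph_nat.
exists (complex.Re c), (complex.Re A); split.
- by rewrite -ltcR cE.
- by rewrite -lecR AE.
move=> n rho p kn rho1 rhon pP rootp.
have zE : `|rho%:C| = rho%:C.
  by apply: ger0_norm; rewrite lecR (le_trans _ rho1).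
have := H n rho%:C p kn.
rewrite zE !nE -[1]/(1%:C) !lecR => /(_ rho1 rhon pP) H'.
rewrite -lecR !(rmorphM, rmorphD, rmorphXn, fmorphV) /= cE AE; apply: H' => a /rootp.
rewrite -lecR RRe_real ?normr_real //.
by rewrite rmorphM fmorphV rmorphXn /= -nE.
Qed.

(** * Real powers of n and passage to the limit *)

Lemma powR_large (R : realType) (e M : R) : 0 < e ->
  exists N : nat, forall n : nat, (N <= n)%N -> M < n%:R `^ e.
Proof.
move=> e0; have M1 : 0 < `|M| + 1 by rewrite ltr_wpDl.
exists (Num.bound ((`|M| + 1) `^ e^-1)) => n Nn.
have /lt_le_trans lt_n := archi_boundP (powR_ge0 (`|M| + 1) e^-1).
have {Nn lt_n} : (`|M| + 1) `^ e^-1 < n%:R by apply: lt_n; rewrite ler_nat.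
move/(gt0_ltr_powR e0); rewrite !nnegrE => /(_ (powR_ge0 _ _) (ler0n _ _)).
rewrite -powRrM mulVf ?gt_eqF // powRr1 ?ltW //; apply: lt_trans.
by rewrite ltr_pwDr // ler_norm.
Qed.

(** The supremum dominates its set only if the set is bounded above; the sum of the moduli of all
    zeros is such a bound. *)
Lemma max_root_modulus_ge (R : realType) (p : {poly R[i]}) (a : R[i]) :
  p != 0 -> root p a -> complex.Re `|a| <= max_root_modulus p.
Proof.
move=> p0 pa; apply: ub_le_sup; last by exists a.
have [s ps] := closed_field_poly_normal p.
exists (\sum_(b <- s) complex.Re `|b|) => _ [z /= pz <-].
have zs : z \in s.
  by move: pz; rewrite ps rootZ ?lead_coef_eq0 // root_prod_XsubC.
rewrite (big_rem z) //= lerDl sumr_ge0 // => b _.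
by rewrite -lecR; exact: (normr_ge0 b).
Qed.

(** Excludes the default value of [xget] for large n: the sum for lambda_n stops at j_0, where its
    coefficient is nonzero, so lambda_n eventually differs from all earlier eigenvalues. *)
Lemma monic_eigenpolyP (R : realType) (k : nat) (Q : nat -> {poly R[i]}) :
  degenerate_exactly_solvable k Q ->
  exists N : nat, forall n, (N <= n)%N ->
    is_monic_eigenpoly k Q n (monic_eigenpoly k Q n).
Proof.
move=> hT; have [_ sizeQ _ _] := hT.
have [/andP[t0 tk] szt topQ] := top_indexP _ _ _ hT.
set t := top_index k Q in t0 tk szt topQ.
have qt : (Q t)`_t != 0.
  have : lead_coef (Q t) != 0 by rewrite lead_coef_eq0 -size_poly_gt0 szt.
  by rewrite lead_coefE szt.
have [N HN] := ffact_sum_neq _ _ (fun j => (Q j)`_j) t0 qt.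
have lamE m : diffop_eigenvalue k Q m =
    \sum_(1 <= j < t.+1) (Q j)`_j * (m ^_ j)%:R.
  rewrite /diffop_eigenvalue (big_cat_nat _ (n := t.+1)) //=; last by rewrite ltnS ltnW.
  rewrite [X in _ + X]big_nat_cond [X in _ + X]big1 ?addr0 // => j /andP[/andP[tj jk] _].
  by rewrite nth_default ?mul0r // topQ // (leq_ltn_trans _ tj).
exists N => n Nn; rewrite /monic_eigenpoly.
case: xgetP => [p -> //|no].
have [|p pP] := exists_monic_eigenpoly _ _ _ n sizeQ.
  by move=> m mn; rewrite eq_sym !lamE HN.
by case: (no p).
Qed.

Theorem corollary2 (R : realType) (k : nat) (Q : nat -> {poly R[i]})
    (hT : degenerate_exactly_solvable k Q)
    (hdeg : forall j : nat, (top_index k Q < j <= k)%N -> Q j != 0 ->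
      size (Q j) = 1%N)
    (gamma : R) (hgamma : gamma < (k%:R - (top_index k Q)%:R) / k%:R) :
  (fun n : nat => max_root_modulus (monic_eigenpoly k Q n) / n%:R `^ gamma)
    @ \oo --> +oo.
Proof.
have [N1 eigP] := monic_eigenpolyP _ _ _ hT.
have [c [A [c0 A0 growth]]] := eigenpoly_growth _ _ _ hT hdeg.
have [/andP[t0 tk] _ _] := top_indexP _ _ _ hT.
set t := top_index k Q in hgamma t0 tk growth.
have k0 : 0 < k%:R :> R by rewrite ltr0n (leq_trans _ tk).
have tkR : t%:R < k%:R :> R by rewrite ltr_nat.
have t0R : 0 < t%:R :> R by rewrite ltr0n.
set b := (k%:R - t%:R) / k%:R in hgamma.
have kb : k%:R * b = k%:R - t%:R by rewrite /b mulrC divfK ?gt_eqF.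
have b0 : 0 < b by rewrite divr_gt0 // subr_gt0.
have b1 : b < 1 by rewrite ltr_pdivrMr // mul1r gtrBl.
(* The midpoint serves three ends: g > 0 and g < b < 1 give 1 <= n^g <= n, g < b yields the
   contradiction, and g > gamma leaves the divergent factor n^(g - gamma). *)
pose g := (Num.max gamma 0 + b) / 2%:R.
have [g0 gamma_g gb] : [/\ 0 < g, gamma < g & g < b].
  rewrite /g; have [m1 m2] : gamma <= Num.max gamma 0 /\ 0 <= Num.max gamma 0.
    by rewrite !le_max !lexx orbT.
  have m3 : Num.max gamma 0 < b by rewrite gt_max hgamma.
  by split; lra.
(* n^e bounds from below the two quotients n^(k (1 - g)) / n^t and n^(1 - g). *)
pose e := Num.min (k%:R * (b - g)) (1 - g).
have e0 : 0 < e by rewrite lt_min mulr_gt0 ?subr_gt0 // (lt_trans gb).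
have [N2 HN2] := powR_large _ e (2%:R * A / c) e0.
have root_large n : (maxn N1 (maxn N2 (2 * k)) < n)%N ->
    n%:R `^ g / 3%:R ^+ k < max_root_modulus (monic_eigenpoly k Q n).
  rewrite !gtn_max => /and3P[/ltnW N1n /ltnW N2n kn].
  have n0 : (0 < n)%N by apply: leq_trans kn.
  have n1 : 1 <= n%:R :> R by rewrite ler1n.
  have nR : 0 < n%:R :> R by rewrite ltr0n.
  have pP := eigP n N1n; set p := monic_eigenpoly k Q n in pP *.
  have p0 : p != 0 by have [/monic_neq0] := pP.
  rewrite ltNge; apply/negP => small.
  have : c * (n%:R / n%:R `^ g) ^+ k <=
      A * (n%:R ^+ t + (n%:R / n%:R `^ g) ^+ k.-1).
    apply: (growth _ _ p) => //; first exact: ltnW.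
    - by rewrite -[leLHS](powRr0 n%:R) ler_powR // ltW.
    - by rewrite -[leRHS]powRr1 ?ler0n // ler_powR // ltW // (lt_trans gb).
    - by move=> a pa; apply: le_trans (max_root_modulus_ge _ _ _ p0 pa) small.
  have wE : n%:R / n%:R `^ g = n%:R `^ (1 - g).
    by rewrite powRB ?powRr1 ?ler0n //; apply/implyP => _; rewrite gt_eqF.
  rewrite wE; set w := n%:R `^ (1 - g).
  have w0 : 0 < w by rewrite powR_gt0.
  have wkE : w ^+ k = n%:R `^ (k%:R * (1 - g)).
    by rewrite -powR_mulrn ?powR_ge0 // -powRrM mulrC.
  have X0 : 0 < n%:R `^ e by rewrite powR_gt0.
  have D (x y : R) : n%:R `^ x * n%:R `^ y = n%:R `^ (x + y).
    by rewrite powRD //; apply/implyP => _; rewrite gt_eqF.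
  have le1 : n%:R ^+ t * n%:R `^ e <= w ^+ k.
    rewrite wkE -powR_mulrn ?ler0n // D ler_powR // -lerBrDl.
    by rewrite ge_min; apply/orP; left; rewrite mulrBr kb; lra.
  have le2 : w ^+ k.-1 * n%:R `^ e <= w ^+ k.
    rewrite -[in leRHS](prednK (leq_trans _ tk)) // exprSr ler_pM2l ?exprn_gt0 //.
    by rewrite ler_powR // ge_min lexx orbT.
  move=> le_growth.
  (* Each of the two terms on the right, times n^e, is at most w^k. Cancelling w^k leaves c n^e <= 2
     A, against the choice of [N2]. *)
  have : c * w ^+ k * n%:R `^ e <= A * (w ^+ k + w ^+ k).
    apply: le_trans (ler_wpM2r (ltW X0) le_growth) _.
    by rewrite -mulrA ler_wpM2l // mulrDl lerD.
  rewrite (_ : A * _ = 2%:R * A * w ^+ k); last by ring.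
  rewrite mulrAC ler_pM2r ?exprn_gt0 // leNgt [c * _]mulrC -ltr_pdivrMr //.
  by rewrite HN2.
have dg0 : 0 < g - gamma by rewrite subr_gt0.
apply/cvgryPge => M.
(* The factor 3^k compensates for the loss in the lower bound n^g / 3^k on the largest root
   modulus. *)
have [N3 HN3] := powR_large _ (g - gamma) (M * 3%:R ^+ k) dg0.
exists (maxn N3 (maxn N1 (maxn N2 (2 * k)))).+1 => //= n.
rewrite /= gtn_max => /andP[/ltnW N3n Nn].
have nR : 0 < n%:R :> R by rewrite ltr0n (leq_ltn_trans _ Nn).
rewrite ler_pdivlMr ?powR_gt0 //.
apply: le_trans (ltW (root_large n Nn)).
rewrite ler_pdivlMr ?exprn_gt0 ?ltr0n // mulrAC -ler_pdivlMr ?powR_gt0 //.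
rewrite -powRB; last by apply/implyP => _; rewrite gt_eqF.
by rewrite ltW // HN3.
Qed.
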